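(* Let $C$ be a real number, let $\bm{P}^*$ be an optimal solution of (REG) and let $\bm{Q}^*$ be an optimal solution of (DCREG), for the same graph $G$ and the same $C$. Then for all $i\neq j$: 1. If $i\sim j$ and $Q_{ij}^*\le -1$, then $Q_{ij}^*=-\frac{1}{P_{ij}^*}$. 2. If $i\sim j$ and $Q_{ij}^*>-1$, then $P_{ij}^*=1$. 3. If $i\not\sim j$ and $Q_{ij}^*<1$, then $P_{ij}^*=0$. 4. If $i\not\sim j$ and $Q_{ij}^*\ge 1$, then $Q_{ij}^*=\frac{1}{1-P_{ij}^*}$.
   Context: $G=(V,E)$ is a simple undirected graph with $V=\{1,\dots,n\}$. For distinct $i,j$ write $i\sim j$ if $\{i,j\}\in E$ and $i\not\sim j$ otherwise. Sums over $i\sim j$, $i\not\sim j$ (and $i\ne j$) are over ordered pairs of distinct indices. $\bm M\succeq 0$ means $\bm M$ is real symmetric positive semidefinite; $\operatorname{diag}\bm M=C$ means all diagonal entries equal $C$; $\log 0=-\infty$. (REG): maximize $\sum_{i\sim j}\log P_{ij}+\sum_{i\not\sim j}\log(1-P_{ij})-C\operatorname{tr}\bm P$ over real symmetric $n\times n$ matrices $\bm P\succeq 0$ with $0\le P_{ij}\le 1$ for all $i\ne j$ (diagonal entries are not otherwise constrained). (DCREG): minimize $$\sum_{i\sim j,\ Q_{ij}>-1}Q_{ij}+\sum_{i\sim j,\ Q_{ij}\le -1}\bigl(-1-\log(-Q_{ij})\bigr)+\sum_{i\not\sim j,\ Q_{ij}\ge 1}\bigl(Q_{ij}-\log Q_{ij}-1\bigr)$$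 over real symmetric $n\times n$ matrices $\bm Q\succeq 0$ with $\operatorname{diag}\bm Q=C$. *)

(* Defs.v *)
From mathcomp Require Import all_boot all_order all_algebra.
From mathcomp Require Import all_classical all_reals all_analysis.

Set Implicit Arguments.
Unset Strict Implicit.
Unset Printing Implicit Defensive.

Import Order.TTheory GRing.Theory Num.Theory.
Local Open Scope ring_scope.

Definition psd (R : realType) (n : nat) (M : 'M[R]_n) : Prop :=
  M^T = M /\ forall x : 'cV[R]_n, 0 <= (x^T *m M *m x) 0 0.

Definition simple_graph (n : nat) (adj : rel 'I_n) : Prop :=
  symmetric adj /\ irreflexive adj.

Definition nonadj (n : nat) (adj : rel 'I_n) : rel 'I_n :=
  fun i j => (i != j) && ~~ adj i j.

Definition REG_feasible (R : realType) (n : nat) (P : 'M[R]_n) : Prop :=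
  psd P /\ forall i j : 'I_n, i != j -> 0 <= P i j <= 1.

(* The objective is extended-real because lne 0 = -oo; on the feasible set
   both logarithms have arguments in [0, 1], so +oo never occurs. *)
Definition REG_obj (R : realType) (n : nat) (adj : rel 'I_n) (C : R)
    (P : 'M[R]_n) : \bar R :=
  (\sum_(i < n) \sum_(j < n | adj i j) lne (P i j)%:E
   + \sum_(i < n) \sum_(j < n | nonadj adj i j) lne (1 - P i j)%:E
   - (C * \tr P)%:E)%E.

Definition REG_optimal (R : realType) (n : nat) (adj : rel 'I_n) (C : R)
    (P : 'M[R]_n) : Prop :=
  REG_feasible P /\
  forall P' : 'M[R]_n, REG_feasible P' ->
    (REG_obj adj C P' <= REG_obj adj C P)%E.

Definition DCREG_feasible (R : realType) (n : nat) (C : R)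
    (Q : 'M[R]_n) : Prop :=
  psd Q /\ forall i : 'I_n, Q i i = C.

Definition DCREG_obj (R : realType) (n : nat) (adj : rel 'I_n)
    (Q : 'M[R]_n) : R :=
  \sum_(i < n) \sum_(j < n | adj i j && (- 1 < Q i j)) Q i j
  + \sum_(i < n) \sum_(j < n | adj i j && (Q i j <= - 1))
      (- 1 - ln (- Q i j))
  + \sum_(i < n) \sum_(j < n | nonadj adj i j && (1 <= Q i j))
      (Q i j - ln (Q i j) - 1).

Definition DCREG_optimal (R : realType) (n : nat) (adj : rel 'I_n) (C : R)
    (Q : 'M[R]_n) : Prop :=
  DCREG_feasible C Q /\
  forall Q' : 'M[R]_n, DCREG_feasible C Q' ->
    DCREG_obj adj Q <= DCREG_obj adj Q'.

(* Main.v *)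
(* The two problems are dual. For P and Q feasible, <P, Q> >= 0 and Fenchel's
   inequality ln p + q p <= h(q), applied to each off-diagonal entry, show that
   the objective of (REG) at P is at most that of (DCREG) at Q, with equality
   only if every P_ij is the maximizer h'(Q_ij), which is the claim. Equality
   holds at the optima because an optimal Q yields a feasible P of equal value:
   take P_ij = h'(Q_ij) off the diagonal, and the diagonal that makes <P, Q>
   vanish. Positive semidefiniteness of this P is the first-order optimality
   condition of Q along rescaled rank-one perturbations of its Gram matrix. *)
Require Import Defs.
From mathcomp Require Import all_boot all_order all_algebra.
From mathcomp Require Import all_classical all_reals all_analysis.
From mathcomp Require Import ring lra.

Set Implicit Arguments.
Unset Strict Implicit.
Unset Printing Implicit Defensive.

Import Order.TTheory GRing.Theory Num.Theory.
Import numFieldNormedType.Exports.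
Local Open Scope ring_scope.

(** * Logarithm bounds and limits of polynomials at [0] *)

(** [1 + x < expR x] is strict off [0]; this makes the maximizer in Fenchel's inequality unique. *)
Lemma ln_eq_subr1 (R : realType) (u : R) : 0 < u -> ln u = u - 1 -> u = 1.
Proof.
move=> u0 e; apply/eqP/negPn/negP => u1.
have := @expR_gt1Dx R (u - 1); rewrite subr_eq0 => /(_ u1).
by rewrite -e lnK ?posrE// e addrC subrK ltxx.
Qed.

Lemma ln_le_subr1 (R : realType) (u : R) : 0 < u -> ln u <= u - 1.
Proof.
move=> u0; have -> : u = 1 + (u - 1) by ring.
by apply: le_trans (le_ln1Dx _) _; lra.
Qed.

(** Continuity at [0]. It extracts first-order conditions when a difference quotient is bounded by a
    polynomial, without derivatives. *)
Lemma horner0_ge0 (R : realType) (p : {poly R}) (t0 : R) : 0 < t0 ->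
  (forall t, 0 < t -> t <= t0 -> 0 <= p.[t]) -> 0 <= p.[0].
Proof.
move=> t00 pge; rewrite leNgt; apply/negP => p0.
have : \forall t \near (0 : R), p.[t] < 0.
  exact: (cvgr_lt _ (@continuous_horner R p 0)).
move=> /nbhs_ballP[e /= e0 be].
pose t := Num.min t0 (e / 2).
have t_gt0 : 0 < t by rewrite lt_min t00 divr_gt0.
have : p.[t] < 0.
  apply: be; rewrite /ball /= sub0r normrN gtr0_norm//.
  by rewrite /t gt_min; apply/orP; right; lra.
by rewrite ltNge pge// ge_min lexx.
Qed.

(** * Quadratic forms and positive semidefinite matrices *)

Definition qform (R : realType) (n : nat) (M : 'M[R]_n) (x : 'I_n -> R) : R :=
  \sum_i \sum_j x i * M i j * x j.

Lemma psdP (R : realType) (n : nat) (M : 'M[R]_n) :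
  psd M <-> (forall i j, M i j = M j i) /\ forall x, 0 <= qform M x.
Proof.
have E (x : 'cV[R]_n) : (x^T *m M *m x) 0 0 = qform M (fun i => x i 0).
  rewrite mxE /qform exchange_big/=; apply: eq_bigr => j _.
  by rewrite mxE mulr_suml; apply: eq_bigr => i _; rewrite !mxE.
split=> -[sM qM]; split.
- by move=> i j; rewrite -{1}sM mxE.
- move=> x; have := qM (\col_i x i); rewrite E.
  by congr (0 <= _); apply: eq_bigr => i _; apply: eq_bigr => j _; rewrite !mxE.
- by apply/matrixP => i j; rewrite mxE sM.
- by move=> x; rewrite E.
Qed.

Lemma sum_mul_delta (R : realType) (n : nat) (k : 'I_n) (F : 'I_n -> R) :
  \sum_i F i * (i == k)%:R = F k.
Proof.
rewrite (bigD1 k)//= eqxx mulr1 big1 ?addr0// => i /negbTE ->.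
by rewrite mulr0.
Qed.

Lemma qform_delta (R : realType) (n : nat) (M : 'M[R]_n) (k : 'I_n) :
  qform M (fun i => (i == k)%:R) = M k k.
Proof.
rewrite /qform (eq_bigr (fun i => M i k * (i == k)%:R)) ?sum_mul_delta// => i _.
by rewrite sum_mul_delta mulrC.
Qed.

Lemma qform_subr_delta (R : realType) (n : nat) (M : 'M[R]_n) (x : 'I_n -> R)
    (k : 'I_n) (c : R) : (forall i j, M i j = M j i) ->
  qform M (fun i => x i - c * (i == k)%:R) =
  qform M x - 2 * c * (\sum_j M k j * x j) + c ^+ 2 * M k k.
Proof.
move=> sM; rewrite /qform.
have E i : \sum_j (x i - c * (i == k)%:R) * M i j * (x j - c * (j == k)%:R) =
   (\sum_j x i * M i j * x j - c * M k i * x i)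
    + (- c * \sum_j M i j * x j + c ^+ 2 * M i k) * (i == k)%:R.
  transitivity (\sum_j (x i * M i j * x j +
     (- c * (i == k)%:R * (M i j * x j)
      + (- c * x i * M i j + c ^+ 2 * (i == k)%:R * M i j) * (j == k)%:R))).
    by apply: eq_bigr => j _; ring.
  rewrite !big_split/= sum_mul_delta -mulr_sumr (sM k i); ring.
rewrite (eq_bigr _ (fun i _ => E i)) big_split/= sum_mul_delta sumrB.
under [X in _ - X + _ = _]eq_bigr do rewrite -mulrA.
rewrite -mulr_sumr; ring.
Qed.

Lemma psd_diag0 (R : realType) (n : nat) (M : 'M[R]_n) (k j : 'I_n) :
  psd M -> M k k = 0 -> M k j = 0.
Proof.
move=> /psdP[sM qM] k0; apply/eqP/negPn/negP => kj.
(* As [M k k = 0], the form is affine in the coefficient of the [k]-th unit vector; this coefficient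
   gives it the value [-1]. *)
have := qM (fun i => (i == j)%:R - (M j j + 1) / (2 * M k j) * (i == k)%:R).
rewrite qform_subr_delta// k0 mulr0 addr0 sum_mul_delta qform_delta.
have -> : 2 * ((M j j + 1) / (2 * M k j)) * M k j = M j j + 1 by field.
lra.
Qed.

(* Elimination: subtracting [col k *m row k / M k k] from P keeps it psd and
   kills the k-th diagonal entry, so P is a sum of rank-one psd matrices. *)
Lemma psd_frobenius_ge0 (R : realType) (n : nat) (P Q : 'M[R]_n) :
  psd P -> psd Q -> 0 <= \sum_i \sum_j Q i j * P i j.
Proof.
move=> + psdQ; have [m] := ubnP #|[pred k | P k k != 0]|.
elim: m P => // m IH P; rewrite ltnS => cardP psdP0.
have [k /= k0|allz] := pickP [pred k | P k k != 0]; last first.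
  rewrite big1// => i _; rewrite big1// => j _.
  rewrite (psd_diag0 j psdP0) ?mulr0//.
  by have := allz i; rewrite /= => /negbFE/eqP.
have [sP qP] := (psdP P).1 psdP0; have [sQ qQ] := (psdP Q).1 psdQ.
pose P' := \matrix_(i, j) (P i j - P k i * P k j / P k k).
have psdP' : psd P'.
  apply/psdP; split => [i j|x]; first by rewrite !mxE sP; ring.
  pose b := \sum_j P k j * x j.
  have -> : qform P' x = qform P x - b ^+ 2 / P k k.
    have -> : b ^+ 2 / P k k = \sum_i \sum_j P k i * x i * (P k j * x j) / P k k.
      rewrite expr2 {1}/b !mulr_suml; apply: eq_bigr => i _.
      by rewrite /b mulr_sumr mulr_suml.
    rewrite /qform -sumrB; apply: eq_bigr => i _; rewrite -sumrB.
    by apply: eq_bigr => j _; rewrite mxE; field.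
  (* This shift of [x] completes the square in the [k]-th coordinate. *)
  have := qP (fun i => x i - b / P k k * (i == k)%:R).
  rewrite qform_subr_delta// -/b; congr (0 <= _); field => //.
have Pkk : 0 < P k k.
  rewrite lt_neqAle eq_sym k0/=.
  by rewrite -qform_delta.
have : 0 <= \sum_i \sum_j Q i j * P' i j.
  apply: IH => //; apply: leq_trans cardP.
  apply: proper_card; apply/properP; split; last first.
    by exists k; rewrite !inE// mxE mulfK ?subrr ?eqxx.
  apply/fintype.subsetP => i; rewrite !inE; apply: contra => /eqP i0.
  by rewrite mxE i0 sP (psd_diag0 k psdP0 i0) !mul0r subr0.
(* The rank-one matrix that was removed pairs with [Q] to the value of its form at row [k] of [P],
   over [P k k]. *)
have := divr_ge0 (qQ (fun i => P k i)) (ltW Pkk).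
move=> /addr_ge0 H /H; congr (0 <= _).
rewrite /qform mulr_suml -big_split/=; apply: eq_bigr => i _.
rewrite mulr_suml -big_split/=; apply: eq_bigr => j _.
by rewrite mxE; field.
Qed.

(** * Fenchel's inequality for the logarithm, for edges and non-edges *)

(* The maximum of [ln p + q * p] over [0 < p <= 1], and the point at which it is
   attained, which is also the derivative of [conj_ln]. *)
Definition conj_ln (R : realType) (q : R) : R :=
  if -1 < q then q else -1 - ln (- q).

Definition conj_ln_slope (R : realType) (q : R) : R :=
  if -1 < q then 1 else - q^-1.

Lemma conj_ln_slope_itv (R : realType) (q : R) : 0 < conj_ln_slope q <= 1.
Proof.
rewrite /conj_ln_slope; case: (ltP (-1) q) => q1; first by rewrite ltr01 lexx.
have q0 : 0 < - q by lra.
by rewrite -invrN invr_gt0 q0/= invf_le1//; lra.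
Qed.

(** For [-1 < q], add [ln p <= p - 1] and [(p - 1) * (1 + q) <= 0]; otherwise it is [ln u <= u - 1]
    at [u = p * - q]. *)
Lemma fenchel_ln (R : realType) (p q : R) : 0 < p <= 1 ->
  ln p + q * p <= conj_ln q ?= iff (p == conj_ln_slope q).
Proof.
move=> /andP[p0 p1]; rewrite /conj_ln /conj_ln_slope.
case: (ltP (-1) q) => q1.
  have l := ln_le_subr1 p0; have m : (p - 1) * (1 + q) <= 0 by nra.
  split; first by nra.
  apply/eqP/eqP => [e|->]; last by rewrite ln1; ring.
  by apply: ln_eq_subr1 => //; nra.
have q0 : 0 < - q by lra.
have qn0 : q != 0 by lra.
have u0 : 0 < p * - q by exact: mulr_gt0.
have := ln_le_subr1 u0; rewrite lnM ?posrE// => l.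
split; first by nra.
apply/eqP/eqP => [e|pE].
  have : p * - q = 1 by apply: ln_eq_subr1 => //; rewrite lnM ?posrE//; nra.
  by move=> e1; apply: (mulIf (x := - q)); rewrite ?oppr_eq0// e1; field.
have : p * - q = 1 by rewrite pE; field.
move=> e1; have := congr1 (@ln R) e1; rewrite lnM ?posrE// ln1; nra.
Qed.

(** The slope is constant or [- q^-1] with [q <= -1], whose derivative [q^-2] is at most [1]. *)
Lemma conj_ln_slope_lip (R : realType) (q q' : R) :
  (conj_ln_slope q' - conj_ln_slope q) * (q' - q) <= (q' - q) ^+ 2.
Proof.
(* Trading [- a^-1] for [b] with [a * b = -1] leaves polynomial inequalities. *)
have inv1 (a : R) : a <= -1 -> exists b, [/\ - a^-1 = b, 0 < b, b <= 1 & a * b = -1].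
  move=> a1; exists (- a^-1); have a0 : a != 0 by lra.
  have an : 0 < - a by lra.
  rewrite -invrN invr_gt0 an invf_le1// invrN; split=> //; first lra.
  by field.
rewrite /conj_ln_slope; case: (ltP (-1) q') => h'; case: (ltP (-1) q) => h.
- by rewrite subrr mul0r sqr_ge0.
- have [b [-> b0 b1 ab]] := inv1 _ h.
  have s : 1 - b <= q' - q by nra.
  by rewrite expr2 ler_wpM2r//; lra.
- have [b [-> b0 b1 ab]] := inv1 _ h'.
  have s : 1 - b <= q - q' by nra.
  by rewrite expr2 ler_wnM2r//; lra.
- have [b [-> b0 b1 ab]] := inv1 _ h; have [c [-> c0 c1 ac]] := inv1 _ h'.
  have -> : c - b = (q' - q) * (b * c) by nra.
  have bc : b * c <= 1 by nra.
  have : 0 <= (q' - q) ^+ 2 by exact: sqr_ge0.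
  nra.
Qed.

(* The non-edge case reduces to the edge case by [p := 1 - p], [q := - q]. *)
Definition edge_prob (R : realType) (b : bool) (p : R) : R :=
  if b then p else 1 - p.

Definition edge_cost (R : realType) (b : bool) (q : R) : R :=
  if b then conj_ln q else q + conj_ln (- q).

Definition edge_slope (R : realType) (b : bool) (q : R) : R :=
  if b then conj_ln_slope q else 1 - conj_ln_slope (- q).

Lemma edge_prob_slope_itv (R : realType) (b : bool) (q : R) :
  0 < edge_prob b (edge_slope b q) <= 1.
Proof.
rewrite /edge_prob /edge_slope.
by case: b; rewrite ?opprB ?(addrCA 1) ?subrr ?addr0 conj_ln_slope_itv.
Qed.

Lemma edge_slope_itv (R : realType) (b : bool) (q : R) : 0 <= edge_slope b q <= 1.
Proof.
have := edge_prob_slope_itv b q; rewrite /edge_prob; case: b => /andP[? ?]; lra.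
Qed.

Lemma fenchel_edge (R : realType) (b : bool) (p q : R) : 0 < edge_prob b p <= 1 ->
  ln (edge_prob b p) + q * p <= edge_cost b q ?= iff (p == edge_slope b q).
Proof.
case: b; rewrite /edge_prob /edge_cost /edge_slope; first exact: fenchel_ln.
move=> /(fenchel_ln (- q))[le eq].
split; first by lra.
have -> : (p == 1 - conj_ln_slope (- q)) = (1 - p == conj_ln_slope (- q)).
  by apply/eqP/eqP => ?; lra.
by rewrite -eq; apply/eqP/eqP => ?; lra.
Qed.

(* The slope at q' is a subgradient, and slopes are 1-Lipschitz. *)
Lemma edge_cost_upper (R : realType) (b : bool) (q q' : R) :
  edge_cost b q' <= edge_cost b q + edge_slope b q * (q' - q) + (q' - q) ^+ 2.
Proof.
have [_ e] := fenchel_edge q' (edge_prob_slope_itv b q').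
have [l _] := fenchel_edge q (edge_prob_slope_itv b q').
move: e; rewrite eqxx => /eqP e.
have : (edge_slope b q' - edge_slope b q) * (q' - q) <= (q' - q) ^+ 2.
  rewrite /edge_slope; case: b {e l}; first exact: conj_ln_slope_lip.
  have := conj_ln_slope_lip (- q) (- q'); nra.
nra.
Qed.

(** * Both objectives as sums over off-diagonal entries *)

Lemma DCREG_objE (R : realType) (n : nat) (adj : rel 'I_n) (Q : 'M[R]_n) :
  irreflexive adj ->
  DCREG_obj adj Q = \sum_i \sum_(j | i != j) edge_cost (adj i j) (Q i j).
Proof.
move=> irr; rewrite /DCREG_obj -!big_split/=; apply: eq_bigr => i _.
rewrite (big_mkcond (fun j => adj i j && (-1 < _))).
rewrite (big_mkcond (fun j => adj i j && (_ <= -1))).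
rewrite (big_mkcond (fun j => nonadj adj i j && _)) [RHS]big_mkcond/=.
rewrite -!big_split/=; apply: eq_bigr => j _.
have [<-|ij] := eqVneq i j; first by rewrite /nonadj irr eqxx !addr0.
rewrite /nonadj ij /edge_cost /conj_ln/= ltrN2 opprK.
(* A non-edge with [Q i j < 1] costs [q + (- q) = 0], hence has no term in (DCREG). *)
case: (adj i j) => /=; last by case: ltP => _; rewrite ?addr0 ?subrr; ring.
by rewrite !addr0; case: ltP => _; ring.
Qed.

Lemma REG_objE (R : realType) (n : nat) (adj : rel 'I_n) (C : R) (P : 'M[R]_n) :
  irreflexive adj ->
  (forall i j, i != j -> 0 < edge_prob (adj i j) (P i j)) ->
  REG_obj adj C P =
  (\sum_i \sum_(j | i != j) ln (edge_prob (adj i j) (P i j)) - C * \tr P)%:E.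
Proof.
move=> irr pos; rewrite /REG_obj.
have nirr i j : adj i j -> i != j by apply: contraTneq => ->; rewrite irr.
under eq_bigr => i _.
  rewrite (eq_bigr (fun j => (ln (P i j))%:E)); last first.
    by move=> j aij; rewrite lne_EFin//; have := pos _ _ (nirr _ _ aij); rewrite aij.
  rewrite sumEFin; over.
rewrite sumEFin.
under [X in (_ + X - _)%E]eq_bigr => i _.
  rewrite (eq_bigr (fun j => (ln (1 - P i j))%:E)); last first.
    move=> j /andP[ij /negbTE aij]; rewrite lne_EFin//.
    by have := pos _ _ ij; rewrite aij.
  rewrite sumEFin; over.
rewrite sumEFin -EFinD -big_split/=; congr (_ - _)%:E.
apply: eq_bigr => i _; 
rewrite (big_mkcond (adj i)) (big_mkcond (nonadj adj i)) [RHS]big_mkcond/=.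
rewrite -!big_split/=; apply: eq_bigr => j _; rewrite /nonadj.
have [<-|ij] := eqVneq i j; first by rewrite irr addr0.
by rewrite /edge_prob; case: (adj i j); rewrite ?addr0 ?add0r.
Qed.

(** [lne] is [-oo] at nonpositive arguments, and [-oo] absorbs any sum. *)
Lemma REG_obj_gtNy (R : realType) (n : nat) (adj : rel 'I_n) (C : R) (P : 'M[R]_n) :
  (-oo < REG_obj adj C P)%E ->
  forall i j, i != j -> 0 < edge_prob (adj i j) (P i j).
Proof.
move=> gtNy i j ij; rewrite ltNge; apply/negP => le0; move: gtNy.
suff -> : REG_obj adj C P = -oo%E by rewrite ltxx.
rewrite /REG_obj; case: (boolP (adj i j)) le0 => aij; rewrite /edge_prob => le0.
  suff -> : (\sum_(i < n) \sum_(j < n | adj i j) lne (P i j)%:E = -oo)%E by [].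
  apply/esum_eqNyP; exists i; split=> //; apply/esum_eqNyP; exists j; split=> //.
  by rewrite le0_lneNy// lee_fin.
suff -> : (\sum_(i < n) \sum_(j < n | nonadj adj i j) lne (1 - P i j)%:E = -oo)%E.
  by rewrite addeNy.
apply/esum_eqNyP; exists i; split=> //; apply/esum_eqNyP; exists j; split=> //.
  by rewrite /nonadj ij.
by rewrite le0_lneNy// lee_fin.
Qed.

(** * Construction of a feasible [P] from an optimal [Q] *)

(** With [S] the diagonal matrix of [s], this is [S Q S + t y y^T] plus a nonnegative diagonal
    matrix that restores [C]. An inequality on [s] suffices, so no square root is needed. *)
Lemma DCREG_feasible_perturb (R : realType) (n : nat) (C t : R) (Q : 'M[R]_n)
    (s y : 'I_n -> R) : DCREG_feasible C Q -> 0 <= t ->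
  (forall i, s i ^+ 2 * C + t * y i ^+ 2 <= C) ->
  DCREG_feasible C (\matrix_(i, j)
    if i == j then C else s i * s j * Q i j + t * (y i * y j)).
Proof.
move=> [/psdP[sQ qQ] dQ] t0 sC; split; last by move=> i; rewrite mxE eqxx.
apply/psdP; split => [i j|x].
  by rewrite !mxE eq_sym; case: eqP => // _; rewrite sQ; ring.
set M := \matrix_(_, _) _.
have -> : qform M x = qform Q (fun i => s i * x i) + t * (\sum_i y i * x i) ^+ 2
    + \sum_i (C - (s i ^+ 2 * C + t * y i ^+ 2)) * x i ^+ 2.
  have -> : t * (\sum_i y i * x i) ^+ 2 =
      \sum_i \sum_j t * (y i * x i) * (y j * x j).
    rewrite expr2 mulrA [t * _]mulr_sumr mulr_suml; apply: eq_bigr => i _.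
    by rewrite mulr_sumr.
  rewrite /qform -!big_split/=; apply: eq_bigr => i _.
  rewrite -(sum_mul_delta i (fun=> (C - (s i ^+ 2 * C + t * y i ^+ 2)) * x i ^+ 2)).
  rewrite -!big_split/=.
  apply: eq_bigr => j _; rewrite mxE [j == i]eq_sym.
  by case: eqVneq => [<-|_]; rewrite ?dQ /=; ring.
apply: addr_ge0; first by apply: addr_ge0 => //; apply: mulr_ge0 (sqr_ge0 _).
apply: sumr_ge0 => i _.
by apply: mulr_ge0; [rewrite subr_ge0 | exact: sqr_ge0].
Qed.

(** The diagonal stays a parameter because its choice depends on the sign of [C]. *)
Definition dual_certificate (R : realType) (n : nat) (adj : rel 'I_n)
    (Q : 'M[R]_n) (D : 'I_n -> R) : 'M[R]_n :=
  \matrix_(i, j) if i == j then D i else edge_slope (adj i j) (Q i j).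

Lemma qform_certificate (R : realType) (n : nat) (adj : rel 'I_n)
    (Q : 'M[R]_n) (D y : 'I_n -> R) :
  qform (dual_certificate adj Q D) y =
  \sum_i \sum_(j | i != j) edge_slope (adj i j) (Q i j) * (y i * y j)
  + \sum_i D i * y i ^+ 2.
Proof.
rewrite /qform -big_split/=; apply: eq_bigr => i _.
rewrite (bigD1 i)//= mxE eqxx addrC; congr (_ + _); last by ring.
apply: eq_big => [j|j ij]; first by rewrite eq_sym.
by rewrite mxE eq_sym (negbTE ij); ring.
Qed.

(* First-order optimality of Q along the feasible curve
   [s_i s_j Q_ij + t y_i y_j], where [s_i = 1 - u - u^2] with
   [u = t y_i^2 / (2 C)] is a polynomial minorant of [sqrt (1 - 2 u)]. *)
Lemma certificate_psd (R : realType) (n : nat) (adj : rel 'I_n) (C : R)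
    (Q : 'M[R]_n) : simple_graph adj -> 0 < C -> DCREG_optimal adj C Q ->
  psd (dual_certificate adj Q
    (fun i => - (\sum_(j | i != j) edge_slope (adj i j) (Q i j) * Q i j) / C)).
Proof.
move=> [sadj irr] C0 [fQ optQ]; have [/psdP[sQ _] dQ] := fQ.
pose A i j := edge_slope (adj i j) (Q i j).
have sA i j : A i j = A j i by rewrite /A sadj sQ.
apply/psdP; split=> [i j|y].
  by rewrite !mxE eq_sym; case: eqP => [->//|_]; exact: sA.
rewrite qform_certificate.
pose a i := y i ^+ 2 / (2 * C).
have a0 i : 0 <= a i by rewrite divr_ge0 ?sqr_ge0//; lra.
(* Chosen so that [s i = 1 - t * (B i).[t]]; then [(E i j).[t]] is the change of [Q i j] divided by
   [t]. *)
pose B i : {poly R} := (a i)%:P + (a i ^+ 2)%:P * 'X.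
pose E i j : {poly R} := (y i * y j)%:P
  + (Q i j)%:P * ('X * B i * B j - B i - B j).
have hE i j t : (E i j).[t] = y i * y j + Q i j * (t * (a i + a i ^+ 2 * t)
    * (a j + a j ^+ 2 * t) - (a i + a i ^+ 2 * t) - (a j + a j ^+ 2 * t)).
  by rewrite /E /B !(hornerD, hornerN, hornerM, hornerX, hornerC).
(* By [edge_cost_upper], [p.[t]] bounds the change of the objective divided by [t]; its value at [0]
   is the quadratic form of the certificate. *)
pose p : {poly R} :=
  \sum_i \sum_(j | i != j) ((A i j)%:P * E i j + 'X * E i j ^+ 2).
have hp t : p.[t] = \sum_i \sum_(j | i != j)
    (A i j * (E i j).[t] + t * (E i j).[t] ^+ 2).
  rewrite /p horner_sum; apply: eq_bigr => i _.
  rewrite horner_sum; apply: eq_bigr => j _.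
  by rewrite hornerD !hornerM hornerX hornerC.
have -> : \sum_i \sum_(j | i != j) A i j * (y i * y j)
    + \sum_i - (\sum_(j | i != j) A i j * Q i j) / C * y i ^+ 2 = p.[0].
  rewrite hp.
  (* The two halves match the terms in [a i] and [a j] of [(E i j).[0]]; they are equal by symmetry
     of [A] and [Q]. *)
  have -> : \sum_i - (\sum_(j | i != j) A i j * Q i j) / C * y i ^+ 2 =
      \sum_i \sum_(j | i != j) - (a i * (A i j * Q i j))
      + \sum_i \sum_(j | i != j) - (a j * (A i j * Q i j)).
    rewrite [X in _ = _ + X](exchange_big_dep predT)//= -big_split/=.
    apply: eq_bigr => i _.
    rewrite [X in _ = _ + X](eq_big (fun j => i != j)
      (fun j => - (a i * (A i j * Q i j)))); last 2 first.
    - by move=> j; rewrite eq_sym.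
    - by move=> j _; rewrite sA sQ.
    rewrite sumrN -mulr_sumr /a; field; lra.
  rewrite -!big_split/=; apply: eq_bigr => i _; rewrite -!big_split/=.
  by apply: eq_bigr => j _; rewrite hE; ring.
(* Feasibility needs [u ^+ 2 + 2 * u <= 1] for every [u = t * a i]; this [t0] ensures [u <= 1/3]. *)
pose t0 := (3 * (1 + \sum_i a i))^-1.
have sa0 : 0 <= \sum_i a i by rewrite sumr_ge0.
have t00 : 0 < t0 by rewrite invr_gt0; lra.
apply: (horner0_ge0 t00) => t tgt tle.
have at3 i : t * a i <= 3^-1.
  have ai : a i <= \sum_i a i by rewrite (bigD1 i)//= lerDl sumr_ge0.
  have : t0 * (3 * (1 + \sum_i a i)) = 1 by rewrite mulVf//; lra.
  have := a0 i; nra.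
pose s i := 1 - t * a i - (t * a i) ^+ 2.
have := optQ _ (@DCREG_feasible_perturb R n C t Q s y fQ (ltW tgt) _).
set Q' := \matrix_(_, _) _ => /(_ _)/wrap[].
  move=> i; have -> : t * y i ^+ 2 = 2 * (t * a i) * C by rewrite /a; field; lra.
  have := at3 i; have : 0 <= t * a i by rewrite mulr_ge0// ltW.
  rewrite /s; move: (t * a i) => u u0 u3.
  have : (1 - u - u ^+ 2) ^+ 2 + 2 * u <= 1 by nra.
  nra.
rewrite !DCREG_objE// => le.
have d i j : i != j -> Q' i j - Q i j = t * (E i j).[t].
  by move=> /negbTE ij; rewrite mxE ij hE /s; ring.
rewrite -(pmulr_rge0 _ tgt) hp -(lerDl
  (\sum_i \sum_(j | i != j) edge_cost (adj i j) (Q i j))).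
apply: le_trans le _; rewrite mulr_sumr -big_split/=; apply: ler_sum => i _.
rewrite mulr_sumr -big_split/=; apply: ler_sum => j ij.
apply: le_trans (edge_cost_upper _ (Q i j) _) _; rewrite d//.
by rewrite le_eqVlt; apply/orP; left; apply/eqP; rewrite /A; ring.
Qed.

(** Diagonal dominance: the diagonal contributes [(x i ^+ 2 + x j ^+ 2) / 2] for each pair, which
    outweighs [x i * M i j * x j]. *)
Lemma psd_diag_large (R : realType) (n : nat) (M : 'M[R]_n) :
  (forall i j, M i j = M j i) -> (forall i, M i i = n%:R) ->
  (forall i j, i != j -> 0 <= M i j <= 1) -> psd M.
Proof.
move=> sM dM M01; apply/psdP; split=> // x.
have -> : qform M x = \sum_i \sum_(j | i != j) x i * M i j * x j
    + \sum_i \sum_j 2^-1 * (x i ^+ 2 + x j ^+ 2).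
  have -> : \sum_i \sum_j 2^-1 * (x i ^+ 2 + x j ^+ 2) = \sum_i n%:R * x i ^+ 2.
    under eq_bigr => i _ do rewrite -mulr_sumr big_split/= sumr_const card_ord.
    rewrite -[LHS]mulr_sumr big_split/= sumr_const card_ord sumrMnl.
    by rewrite -mulr_sumr -mulr_natl; field.
  rewrite /qform -big_split/=; apply: eq_bigr => i _.
  rewrite (bigD1 i)//= dM addrC; congr (_ + _); last by ring.
  by apply: eq_bigl => j; rewrite eq_sym.
rewrite -big_split/=; apply: sumr_ge0 => i _.
rewrite [X in X + _]big_mkcond -big_split/=; apply: sumr_ge0 => j _.
case: ifPn => [ij|_]; last by have := sqr_ge0 (x i); have := sqr_ge0 (x j); lra.
have /andP[m0 m1] := M01 _ _ ij.
have := sqr_ge0 (x i + x j); have := sqr_ge0 (x i - x j).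
nra.
Qed.

(** The equation is complementary slackness: the certificate is orthogonal to [Q], whose diagonal is
    [C]. *)
Lemma exists_certificate (R : realType) (n : nat) (adj : rel 'I_n) (C : R)
    (Q : 'M[R]_n) : simple_graph adj -> DCREG_optimal adj C Q ->
  exists D : 'I_n -> R, psd (dual_certificate adj Q D) /\
    \sum_i \sum_(j | i != j) Q i j * edge_slope (adj i j) (Q i j)
    + C * \sum_i D i = 0.
Proof.
move=> hG hQ; have [[psdQ dQ] _] := hQ; have [_ qQ] := (psdP Q).1 psdQ.
have [C0|C0] := ltP 0 C.
  eexists; split; first exact: certificate_psd hG C0 hQ.
  rewrite mulr_sumr -big_split/= big1// => i _.
  rewrite mulrCA divff ?mulr1; last by lra.
  by rewrite -sumrB big1// => j _; ring.
(* For [C <= 0] the nonnegative diagonal of [Q] vanishes, and [Q] with it. Slackness is then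
   automatic, and a large diagonal gives semidefiniteness. *)
have Q0 i j : Q i j = 0.
  apply: psd_diag0 => //; rewrite dQ; apply/eqP; rewrite eq_le C0/= -(dQ i).
  by rewrite -qform_delta.
exists (fun=> n%:R); split.
  apply: psd_diag_large => [i j|i|i j ij].
  - by rewrite !mxE eq_sym !Q0 (hG.1 i); case: eqP.
  - by rewrite mxE eqxx.
  - by rewrite mxE (negbTE ij) edge_slope_itv.
rewrite big1 ?add0r => [|i _]; last by rewrite big1// => j _; rewrite Q0 mul0r.
by rewrite mulr_sumr big1// => i _; rewrite -(dQ i) Q0 mul0r.
Qed.

(** * Vanishing of the duality gap *)

Lemma optimal_edge_slope (R : realType) (n : nat) (adj : rel 'I_n) (C : R)
    (P Q : 'M[R]_n) : simple_graph adj -> REG_optimal adj C P ->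
  DCREG_optimal adj C Q ->
  forall i j, i != j -> P i j = edge_slope (adj i j) (Q i j).
Proof.
move=> hG [[psdP0 P01] optP] hQ; have [sadj irr] := hG.
have [D [psdA slack]] := exists_certificate hG hQ; have [[psdQ dQ] _] := hQ.
set A := dual_certificate adj Q D in psdA.
have AE i j : i != j -> A i j = edge_slope (adj i j) (Q i j).
  by move=> /negbTE ij; rewrite mxE ij.
have posA i j : i != j -> 0 < edge_prob (adj i j) (A i j).
  by move=> ij; rewrite AE//; have /andP[] := edge_prob_slope_itv (adj i j) (Q i j).
have := optP A; rewrite (REG_objE _ irr posA) => /(_ _)/wrap[].
  by split=> // i j ij; rewrite AE// edge_slope_itv.
move=> leP.
(* The value at [P] is at least the finite value at [A], so it exceeds [-oo]. *)
have posP : forall i j, i != j -> 0 < edge_prob (adj i j) (P i j).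
  by apply: (@REG_obj_gtNy _ _ _ C); exact: lt_le_trans (ltNyr _) leP.
move: leP; rewrite (REG_objE _ irr posP) lee_fin => leP.
pose gap i j := edge_cost (adj i j) (Q i j)
  - (ln (edge_prob (adj i j) (P i j)) + Q i j * P i j).
have gap0 i j : i != j -> 0 <= gap i j ?= iff (P i j == edge_slope (adj i j) (Q i j)).
  move=> ij; have [|l e] := @fenchel_edge R (adj i j) (P i j) (Q i j).
    rewrite posP//=; have := P01 _ _ ij; rewrite /edge_prob.
    by case: (adj i j) => /andP[? ?]; lra.
  by split; [rewrite subr_ge0 | rewrite -e eq_sym subr_eq0 eq_sym].
have costA i j : i != j -> edge_cost (adj i j) (Q i j) =
    ln (edge_prob (adj i j) (A i j)) + Q i j * A i j.
  move=> ij; rewrite AE//.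
  by have [_] := fenchel_edge (Q i j) (edge_prob_slope_itv (adj i j) (Q i j));
    rewrite eqxx => /eqP.
have trA : \tr A = \sum_i D i by apply: eq_bigr => i _; rewrite mxE eqxx.
have sum_gap : \sum_i \sum_(j | i != j) gap i j = 0.
  apply/eqP; rewrite eq_le; apply/andP; split; last first.
    by do 2![apply: sumr_ge0 => ? ?]; have [] := gap0 _ _ (ltac:(eassumption)).
  (* By slackness and optimality of [P] against [A], the total gap is at most minus the pairing of
     [P] and [Q]. *)
  have := psd_frobenius_ge0 psdP0 psdQ.
  have -> : \sum_i \sum_j Q i j * P i j =
      \sum_i \sum_(j | i != j) Q i j * P i j + C * \tr P.
    rewrite /mxtrace mulr_sumr -big_split/=; apply: eq_bigr => i _.
    rewrite (bigD1 i)//= dQ addrC; congr (_ + _).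
    by apply: eq_bigl => j; rewrite eq_sym.
  have -> : \sum_i \sum_(j | i != j) gap i j =
      \sum_i \sum_(j | i != j) ln (edge_prob (adj i j) (A i j))
      + \sum_i \sum_(j | i != j) Q i j * edge_slope (adj i j) (Q i j)
      - (\sum_i \sum_(j | i != j) ln (edge_prob (adj i j) (P i j))
         + \sum_i \sum_(j | i != j) Q i j * P i j).
    rewrite -!big_split/= -sumrB; apply: eq_bigr => i _.
    rewrite -!big_split/= -sumrB; apply: eq_bigr => j ij.
    by rewrite /gap costA// AE.
  move: leP slack; rewrite trA; lra.
move=> i j ij; have [l e] := gap0 _ _ ij; apply/eqP; rewrite -e eq_sym; apply/eqP.
have := @psumr_eq0P _ _ predT (fun i => \sum_(j | i != j) gap i j).
move=> /(_ _ sum_gap i erefl) si.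
apply: (@psumr_eq0P _ _ (fun j => i != j) (gap i) _ _ j ij) => [k ik|]; first by have [] := gap0 _ _ ik.
by apply: si => k _; apply: sumr_ge0 => l' kl; have [] := gap0 _ _ kl.
Qed.

Theorem proposition2p4 (R : realType) (n : nat) (adj : rel 'I_n)
    (hG : simple_graph adj) (C : R) (P Q : 'M[R]_n)
    (hP : REG_optimal adj C P) (hQ : DCREG_optimal adj C Q) :
  forall i j : 'I_n, i != j ->
    [/\ adj i j -> Q i j <= - 1 -> Q i j = - (1 / P i j),
        adj i j -> - 1 < Q i j -> P i j = 1,
        ~~ adj i j -> Q i j < 1 -> P i j = 0
      & ~~ adj i j -> 1 <= Q i j -> Q i j = 1 / (1 - P i j)].
Proof.
move=> i j ij; rewrite (optimal_edge_slope hG hP hQ ij).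
rewrite /edge_slope /conj_ln_slope ltrN2; case: (adj i j); split=> // _ q1.
- by rewrite ltNge q1/= div1r invrN invrK opprK.
- by rewrite q1.
- by rewrite q1 subrr.
- by rewrite ltNge q1/= invrN opprK subKr div1r invrK.
Qed.
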